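(* Let $\chi_{f,0}(\mathbb{R}^2)=\sup\{\chi_f(G): G \text{ a finite unit distance graph in } \mathbb{R}^2\}$ and $\chi_{gf,0}(\mathbb{R}^2)=\sup\{\chi_{gf}(G): G \text{ a finite unit distance graph in } \mathbb{R}^2\}$. Then $\chi_{gf,0}(\mathbb{R}^2)=\chi_{f,0}(\mathbb{R}^2)$.
   Context: A unit distance graph in the plane is a graph whose vertex set is a set $X\subseteq\mathbb{R}^2$, with an edge between $x,y\in X$ iff $|x-y|=1$. For a finite unit distance graph $G$, let $\mathcal{I}(G)$ be the set of independent sets of $G$ and $\mathcal{I}(G,x)$ those containing the vertex $x$. A fractional colouring is a function $\gamma:\mathcal{I}(G)\to\mathbb{R}$ with $\gamma(S)\ge 0$ for all $S$ and $\sum_{S\in\mathcal{I}(G,x)}\gamma(S)\ge 1$ for every vertex $x$; its weight is $\sum_{S\in\mathcal{I}(G)}\gamma(S)$. We extend $\gamma$ by $\gamma(S)=0$ for non-independent subsets $S\subseteq G$. The fractional chromatic number $\chi_f(G)$ is the minimum weight of a fractional colouring. A fractional colouring is regular if $\sum_{S\in\mathcal{I}(G,x)}\gamma(S)=1$ for every vertex $x$. A geometric fractional colouring of $G$ is a regular fractional colouring $\gamma$ such that $\sum_{S\supseteq Y}\gamma(S)=\sum_{S'\supseteq Y'}\gamma(S')$ for all pairs of subsets $Y,Y'\subseteq G$ that are geometrically congruent (i.e. $Y'=\varphi(Y)$ for some distance-preserving map $\varphi$ of $\mathbb{R}^2$). The geometric fractional chromatic number $\chi_{gf}(G)$ is the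 minimum weight of a geometric fractional colouring of $G$. *)

(* Defs.v *)
From HB Require Import structures.
From mathcomp Require Import all_boot all_order all_algebra finmap.
From mathcomp Require Import all_classical all_reals all_analysis.

Set Implicit Arguments.
Unset Strict Implicit.
Unset Printing Implicit Defensive.

Import Order.TTheory GRing.Theory Num.Theory.

Local Open Scope classical_set_scope.
Local Open Scope ring_scope.
Local Open Scope fset_scope.

Section UnitDistanceGraphs.
Context {R : realType}.

Definition plane := 'rV[R]_2.

(* The norm that MathComp-Analysis puts on 'rV[R]_2 is the sup norm, hence
   this explicit Euclidean distance. *)
Definition edist (x y : plane) : R :=
  Num.sqrt (\sum_(i < 2) (x ord0 i - y ord0 i) ^+ 2).

Definition unit_adj (x y : plane) : bool := edist x y == 1.

Definition plane_isometry (phi : plane -> plane) : Prop :=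
  forall x y : plane, edist (phi x) (phi y) = edist x y.

Definition congruent (Y Y' : {fset plane}) : Prop :=
  exists phi : plane -> plane,
    plane_isometry phi /\ Y' = [fset phi y | y in Y].

(* A finite unit distance graph is represented by its vertex set X; its edges
   are all the pairs x, y of vertices with unit_adj x y. *)
Definition independent (S : {fset plane}) : bool :=
  [forall x : S, forall y : S, ~~ unit_adj (val x) (val y)].

Definition indep_sets (X : {fset plane}) : {fset {fset plane}} :=
  [fset S in fpowerset X | independent S].

(* A colouring is a total function on finite sets of points that vanishes
   outside indep_sets X, which includes the extension by 0 to the
   non-independent subsets of X. *)
Record frac_colouring (X : {fset plane}) (g : {fset plane} -> R) : Prop := {
  frac_colouring_ge0 : forall S, S \in indep_sets X -> 0 <= g S ;
  frac_colouring_out : forall S, S \notin indep_sets X -> g S = 0 ;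
  frac_colouring_cover : forall x, x \in X ->
    1 <= \sum_(S <- indep_sets X | x \in S) g S }.

Definition weight (X : {fset plane}) (g : {fset plane} -> R) : R :=
  \sum_(S <- indep_sets X) g S.

Definition regular (X : {fset plane}) (g : {fset plane} -> R) : Prop :=
  forall x, x \in X -> \sum_(S <- indep_sets X | x \in S) g S = 1.

Record geom_frac_colouring (X : {fset plane}) (g : {fset plane} -> R) : Prop := {
  geom_frac_colouringW : frac_colouring X g ;
  geom_frac_colouring_regular : regular X g ;
  geom_frac_colouring_congr : forall Y Y' : {fset plane},
    Y `<=` X -> Y' `<=` X -> congruent Y Y' ->
    \sum_(S <- fpowerset X | Y `<=` S) g S =
    \sum_(S <- fpowerset X | Y' `<=` S) g S }.

(* The minimum weight is taken as an infimum in \bar R: finitely many weak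
   linear constraints on g, satisfied by the indicator of the singletons of X,
   and a weight bounded below by 0 make the infimum finite and attained. *)
Definition chi_f (X : {fset plane}) : \bar R :=
  ereal_inf [set (weight X g)%:E | g in [set g | frac_colouring X g]]%classic.

Definition chi_gf (X : {fset plane}) : \bar R :=
  ereal_inf [set (weight X g)%:E | g in [set g | geom_frac_colouring X g]]%classic.

End UnitDistanceGraphs.

Arguments plane R : clear implicits.

Definition chi_f0 (R : realType) : \bar R :=
  ereal_sup [set chi_f X | X in [set: {fset plane R}]]%classic.

Definition chi_gf0 (R : realType) : \bar R :=
  ereal_sup [set chi_gf X | X in [set: {fset plane R}]]%classic.

(* Main.v *)
Require Import Defs.
From mathcomp Require Import all_boot all_order all_algebra finmap.
From mathcomp Require Import all_classical all_reals all_analysis.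
From mathcomp Require Import ring lra.

(* The isometry group of the plane, translations . (rotations . reflection),
   is an iterated extension of commutative groups, hence amenable.  Given a
   finite X and finitely many isometries phi, let L be a finite list of
   isometries almost invariant under right composition with the phi, and take
   a regular fractional colouring of the union of the f X, f in L.  The average
   of its pullbacks along the f in L is a regular fractional colouring of X of
   the same weight, almost invariant under the phi.  A limit along an
   ultrafilter makes the invariance exact, so chi_gf X is at most the supremum
   of chi_f. *)

Set Implicit Arguments.
Unset Strict Implicit.
Unset Printing Implicit Defensive.

Import Order.TTheory GRing.Theory Num.Theory.
Import numFieldNormedType.Exports.

Local Open Scope classical_set_scope.
Local Open Scope fset_scope.
Local Open Scope ring_scope.

(** * Averages over finite lists *)

Section Mean.
Context {R : realType}.

Definition mean {I : Type} (L : seq I) (h : I -> R) : R :=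
  (\sum_(i <- L) h i) / (size L)%:R.

Lemma mean_const {I : Type} (L : seq I) (c : R) :
  (0 < size L)%N -> mean L (fun=> c) = c.
Proof.
move=> L0; rewrite /mean big_const_seq count_predT iter_addr_0 -(mulr_natr c).
by rewrite mulfK// pnatr_eq0 -lt0n.
Qed.

Lemma meanB {I : Type} (L : seq I) (h k : I -> R) :
  mean L h - mean L k = mean L (fun i => h i - k i).
Proof. by rewrite /mean -mulrBl sumrB. Qed.

Lemma eq_mean {I : eqType} (L : seq I) (h k : I -> R) :
  {in L, h =1 k} -> mean L h = mean L k.
Proof. by move=> hk; rewrite /mean (eq_big_seq _ hk). Qed.

Lemma ler_norm_mean {I : eqType} (L : seq I) (h : I -> R) (e : R) :
  (0 < size L)%N -> (forall i, i \in L -> `|h i| <= e) -> `|mean L h| <= e.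
Proof.
move=> L0 he; rewrite /mean normrM normfV normr_nat.
rewrite ler_pdivrMr ?ltr0n// mulr_natr.
rewrite (le_trans (ler_norm_sum _ _ _))// big_seq.
apply: (le_trans (ler_sum _ he)).
by rewrite -big_seq big_const_seq count_predT iter_addr_0.
Qed.

Lemma mean_exchange {I J : Type} (L : seq I) (K : seq J) (h : I -> J -> R) :
  mean L (fun i => mean K (h i)) = mean K (fun j => mean L (h^~ j)).
Proof.
rewrite /mean -!mulr_suml exchange_big -!mulrA; congr (_ * _).
by rewrite mulrC.
Qed.

Lemma mean_allpairs {I J K : Type} (f : I -> J -> K) (L : seq I) (M : seq J)
    (h : K -> R) :
  mean [seq f i j | i <- L, j <- M] h = mean L (fun i => mean M (fun j => h (f i j))).
Proof.
rewrite /mean -mulr_suml big_allpairs_dep size_allpairs natrM invfM -mulrA.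
by congr (_ * _); rewrite mulrC.
Qed.

End Mean.

(** * Amenability of commutative monoids of maps and of extensions *)

Section Amenability.
Context {R : realType} {T : choiceType}.
Implicit Types (P Q : (T -> T) -> Prop) (L s : seq (T -> T)) (f : T -> T).

(** Testing against all [h] bounded by 1 bounds the l1 distance between the uniform distribution on
    [L] and its right translate by [f]; repetitions in [L] count as multiplicities. *)
Definition almost_invariant (e : R) L f : Prop :=
  forall h : (T -> T) -> R, (forall u, `|h u| <= 1) ->
    `|mean L (fun u => h (u \o f)) - mean L h| <= e.

(* Reiter's condition for the right translations of the monoid P. *)
Definition amenable P : Prop :=
  forall s, (forall f, f \in s -> P f) -> forall e : R, 0 < e ->
  exists2 L, (0 < size L)%N /\ (forall u, u \in L -> P u) &
    forall f, f \in s -> almost_invariant e L f.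

(** Induction on [s]: a list [L] good for the tail is multiplied by the powers of [a] below [N].
    Translating by [a] telescopes and leaves two boundary terms, an error of at most [2 / N]; any
    other [f] commutes past the powers, so the estimate for [L] carries over. *)
Lemma amenable_commute P :
  P id -> (forall f g, P f -> P g -> P (f \o g)) ->
  (forall f g, P f -> P g -> f \o g = g \o f) -> amenable P.
Proof.
move=> Pid Pcomp Pcomm; elim=> [_ e e0|a s IHs sP e e0].
  by exists [:: id] => //; split=> // u; rewrite inE => /eqP ->.
have Pa : P a by apply: sP; rewrite mem_head.
have [L [L0 LP] Linv] : exists2 L, (0 < size L)%N /\ (forall u, u \in L -> P u) &
    forall f, f \in s -> almost_invariant e L f.
  by apply: IHs => // f fs; apply: sP; rewrite inE fs orbT.
have Piter i : P (iter i (comp a) id) by elim: i => //= i; exact: Pcomp.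
have [N N0 eN] : exists2 N : nat, (0 < N)%N & 2 / N%:R <= e.
  exists (Num.truncn (2 / e)).+1 => //.
  rewrite ler_pdivrMr ?ltr0n// -ler_pdivrMl// mulrC.
  by apply/ltW/truncnS_gt.
exists [seq f \o iter i (comp a) id | f <- L, i <- iota 0 N].
  rewrite size_allpairs size_iota muln_gt0 L0 N0; split => //.
  by move=> u /allpairsP[[f i] [/LP Pf _ ->]]; exact: Pcomp.
move=> f; rewrite inE => /orP[/eqP ->|fs] h h1.
  rewrite !mean_allpairs meanB; apply: ler_norm_mean => // u _.
  rewrite (le_trans _ eN)// /mean -mulrBl normrM normfV size_iota normr_nat.
  rewrite ler_wpM2r ?invr_ge0//.
  have -> : iota 0 N = index_iota 0 N by rewrite /index_iota subn0.
  rewrite -sumrB.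
  under eq_bigr => i _.
    have -> : (u \o iter i (comp a) id) \o a = u \o iter i.+1 (comp a) id.
      by rewrite /= -compA (Pcomm _ a (Piter i) Pa).
    over.
  rewrite telescope_sumr//.
  apply: (le_trans (ler_normB _ _)).
  by rewrite (_ : 2 = 1 + 1)// lerD.
rewrite !mean_allpairs mean_exchange [X in _ - X]mean_exchange meanB.
apply: ler_norm_mean => [|i _]; first by rewrite size_iota.
rewrite (_ : mean L (fun u => h (_ \o f)) =
  mean L (fun u => h ((u \o f) \o iter i (comp a) id))).
  by apply: (Linv f fs (fun u => h (u \o _))).
apply: eq_mean => u /LP Pu.
by rewrite -compA (Pcomm _ f)//; apply: sP; rewrite inE fs orbT.
Qed.

(* Extension of Q by a normal P: average a mean invariant under the conjugates
   of the P-parts against a mean invariant under the Q-parts. *)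
Lemma amenable_ext P Q :
  amenable P -> amenable Q ->
  (forall q p, Q q -> P p -> exists2 p', P p' & q \o p = p' \o q) ->
  amenable (fun f => exists p q, [/\ P p, Q q & f = p \o q]).
Proof.
move=> aP aQ PQ s sPQ e e0.
have [d dP] : exists d : (T -> T) -> (T -> T) * (T -> T),
    forall f, f \in s -> [/\ P (d f).1, Q (d f).2 & f = (d f).1 \o (d f).2].
  suff /boolp.choice[d dP] : forall f, exists pq : (T -> T) * (T -> T),
    f \in s -> [/\ P pq.1, Q pq.2 & f = pq.1 \o pq.2] by exists d.
  move=> f; have [fs|] := boolP (f \in s); last by exists (id, id).
  by have [p [q Hpq]] := sPQ _ fs; exists (p, q).
(* [c (q, p)] plays the role of the conjugate of [p] by [q]. *)
have [c cP] : exists c : (T -> T) * (T -> T) -> (T -> T),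
    forall q p, Q q -> P p -> P (c (q, p)) /\ q \o p = c (q, p) \o q.
  suff /boolp.choice[c cP] : forall qp : (T -> T) * (T -> T), exists p',
      Q qp.1 -> P qp.2 -> P p' /\ qp.1 \o qp.2 = p' \o qp.1.
    by exists c => q p; exact: cP (q, p).
  case=> q p /=; have [[Qq Pp]|nQP] := pselect (Q q /\ P p).
    by have [p' ? ?] := PQ _ _ Qq Pp; exists p'.
  by exists id => Qq Pp; case: nQP.
have e20 : 0 < e / 2 by rewrite divr_gt0.
(* [K] is chosen before [L], since [L] must be almost invariant under the conjugates by the members
   of [K]. *)
have [|K [K0 KQ] Kinv] := aQ [seq (d f).2 | f <- s] _ _ e20.
  by move=> _ /mapP[f /dP[? ? _] ->].
have [|L [L0 LP] Linv] := aP [seq c (q, (d f).1) | q <- K, f <- s] _ _ e20.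
  by move=> _ /allpairsP[[q f] /= [/KQ Qq /dP[? ? _] ->]]; have [] := cP q (d f).1.
exists [seq p \o q | p <- L, q <- K].
  rewrite size_allpairs muln_gt0 L0 K0; split => //.
  by move=> _ /allpairsP[[p q] [/LP ? /KQ ? ->]]; exists p, q.
move=> f fs h h1; have [Pp Qq fE] := dP _ fs.
rewrite !mean_allpairs [e]splitr.
(* In [x] only the [Q]-part of [f] acts: [K] controls the distance from [x] to the untranslated
   mean, [L] the distance to the translated one. *)
set x := mean L (fun p => mean K (fun q => h (p \o (q \o (d f).2)))).
rewrite -(subrKA x) (le_trans (ler_normD _ _))// lerD//; last first.
  rewrite meanB; apply: ler_norm_mean => // p _.
  apply: (Kinv (d f).2 _ (fun q => h (p \o q))) => //.
  by apply/mapP; exists f.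
rewrite /x mean_exchange [X in _ - X]mean_exchange meanB.
apply: ler_norm_mean => // q qK.
have [_ qc] := cP q (d f).1 (KQ _ qK) Pp.
rewrite (_ : mean L (fun p => h ((p \o q) \o f)) =
  mean L (fun p => h ((p \o c (q, (d f).1)) \o (q \o (d f).2)))).
  apply: (Linv _ _ (fun p => h (p \o (q \o (d f).2)))) => //.
  by apply/allpairsP; exists (q, f).
apply: eq_mean => p _; congr h.
rewrite {1}fE; change (p \o (q \o (d f).1) \o (d f).2 = p \o (c (q, (d f).1) \o q) \o (d f).2).
by rewrite qc.
Qed.

End Amenability.

(** * Classification of plane isometries and amenability of their group *)

Section Isometries.
Context {R : realType}.
Implicit Types (x y v : plane R) (a b : R).

Definition pt a b : plane R := \row_(j < 2) (if j == 0 then a else b).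

Lemma pt0 a b : pt a b 0 0 = a. Proof. by rewrite mxE. Qed.
Lemma pt1 a b : pt a b 0 1 = b. Proof. by rewrite mxE. Qed.

Lemma planeP x y : x 0 0 = y 0 0 -> x 0 1 = y 0 1 -> x = y.
Proof.
move=> e0 e1; apply/rowP => -[[|[|//]] i2].
- by rewrite (_ : Ordinal i2 = 0) //; exact/val_inj.
- by rewrite (_ : Ordinal i2 = 1) //; exact/val_inj.
Qed.

Definition sqdist x y : R := (x 0 0 - y 0 0) ^+ 2 + (x 0 1 - y 0 1) ^+ 2.

(* MathComp-Analysis shadows edist with an extended pseudometric. *)
Lemma edistE x y : Defs.edist x y = Num.sqrt (sqdist x y).
Proof.
rewrite /Defs.edist big_ord_recl big_ord1; congr (Num.sqrt (_ + (_ - _) ^+ 2)).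
all: by congr fun_of_matrix; exact/val_inj.
Qed.

Lemma isometry_sqdist phi :
  plane_isometry phi <-> forall x y, sqdist (phi x) (phi y) = sqdist x y.
Proof.
split=> H x y; last by rewrite !edistE H.
apply/eqP; rewrite -eqr_sqrt ?addr_ge0 ?sqr_ge0//.
by rewrite -!edistE H.
Qed.

Definition translation : (plane R -> plane R) -> Prop :=
  fun f => exists v, f = +%R v.

Definition rot a b x := pt (a * x 0 0 - b * x 0 1) (b * x 0 0 + a * x 0 1).

Definition rotation : (plane R -> plane R) -> Prop :=
  fun f => exists a b, a ^+ 2 + b ^+ 2 = 1 /\ f = rot a b.

Definition refl x := pt (x 0 0) (- x 0 1).

Definition reflection : (plane R -> plane R) -> Prop :=
  fun f => f = id \/ f = refl.

(** After subtracting the image of the origin, an isometry preserves inner products, so the basis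
    vectors have orthonormal images; the sign of their determinant decides whether the reflection
    occurs. *)
Lemma plane_isometryP phi : plane_isometry phi <->
  exists t g, [/\ translation t,
    exists r s, [/\ rotation r, reflection s & g = r \o s] & phi = t \o g].
Proof.
rewrite isometry_sqdist; split; last first.
  case=> _ [_ [[v ->] [_ [s [[a [b [ab ->]]] + ->]]] ->]] x y.
  case=> -> /=; rewrite /sqdist !mxE/=.
    transitivity ((a ^+ 2 + b ^+ 2) *
      ((x 0 0 - y 0 0) ^+ 2 + (x 0 1 - y 0 1) ^+ 2)); first ring.
    by rewrite ab mul1r.
  transitivity ((a ^+ 2 + b ^+ 2) *
    ((x 0 0 - y 0 0) ^+ 2 + (x 0 1 - y 0 1) ^+ 2)); first ring.
  by rewrite ab mul1r.
move=> phiE; pose o := pt 0 0.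
pose u x i := phi x 0 i - phi o 0 i.
have dist0 x : u x 0 ^+ 2 + u x 1 ^+ 2 = x 0 0 ^+ 2 + x 0 1 ^+ 2.
  by have := phiE x o; rewrite /sqdist !mxE/= !subr0.
(* Polarization, from three squared distances. *)
have inner x y : u x 0 * u y 0 + u x 1 * u y 1 = x 0 0 * y 0 0 + x 0 1 * y 0 1.
  have := phiE x y; have := dist0 x; have := dist0 y.
  rewrite /sqdist /u; lra.
pose a := u (pt 1 0) 0; pose b := u (pt 1 0) 1.
pose c := u (pt 0 1) 0; pose d := u (pt 0 1) 1.
have ab : a ^+ 2 + b ^+ 2 = 1.
  by have := dist0 (pt 1 0); rewrite !mxE/= expr1n expr0n addr0.
have cd : c ^+ 2 + d ^+ 2 = 1.
  by have := dist0 (pt 0 1); rewrite !mxE/= expr1n expr0n add0r.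
have ac : a * c + b * d = 0.
  by have := inner (pt 1 0) (pt 0 1); rewrite !mxE/= !(mulr0, mul0r) addr0.
have ix x : a * u x 0 + b * u x 1 = x 0 0.
  by have := inner (pt 1 0) x; rewrite !mxE/= mul0r mul1r addr0.
have iy x : c * u x 0 + d * u x 1 = x 0 1.
  by have := inner (pt 0 1) x; rewrite !mxE/= mul0r mul1r add0r.
(* The determinant; it expresses the second image vector [(c, d)] as [e] times the quarter turn of
   [(a, b)]. *)
pose e := a * d - b * c.
have ce : c = - (e * b).
  transitivity (c * (a ^+ 2 + b ^+ 2) - a * (a * c + b * d)).
    by rewrite ab ac mulr1 mulr0 subr0.
  by rewrite /e; ring.
have de : d = e * a.
  transitivity (d * (a ^+ 2 + b ^+ 2) - b * (a * c + b * d)).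
    by rewrite ab ac mulr1 mulr0 subr0.
  by rewrite /e; ring.
have e2 : e ^+ 2 = 1.
  rewrite -[RHS]cd ce de.
  transitivity (e ^+ 2 * (a ^+ 2 + b ^+ 2)); last by ring.
  by rewrite ab mulr1.
(* Inverts the orthogonal system [ix], [iy]: once substituted, the cross term carries the factor
   [1 - e ^+ 2], which vanishes. *)
have phi0 x : phi x 0 0 = phi o 0 0 + (a * x 0 0 - e * b * x 0 1).
  rewrite -(ix x) -(iy x) ce de.
  transitivity (phi o 0 0 + (a ^+ 2 + e ^+ 2 * b ^+ 2) * u x 0
    + (1 - e ^+ 2) * (a * b) * u x 1); last by ring.
  by rewrite e2 mul1r ab /u; ring.
have phi1 x : phi x 0 1 = phi o 0 1 + (b * x 0 0 + e * a * x 0 1).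
  rewrite -(ix x) -(iy x) ce de.
  transitivity (phi o 0 1 + (b ^+ 2 + e ^+ 2 * a ^+ 2) * u x 1
    + (1 - e ^+ 2) * (a * b) * u x 0); last by ring.
  by rewrite e2 mul1r (addrC (b ^+ 2)) ab /u; ring.
exists (+%R (phi o)), (rot a b \o (if e == 1 then id else refl)).
split; first by exists (phi o).
  exists (rot a b), (if e == 1 then id else refl); split => //.
    by exists a, b.
  by case: ifP; [left|right].
clearbody a b c d e.
have [e1|/negbTE en1] := eqVneq e 1.
  apply/funext => x; apply: planeP.
    by rewrite phi0 [RHS]mxE e1 mul1r /rot pt0.
  by rewrite phi1 [RHS]mxE e1 mul1r /rot pt1.
have eN1 : e = -1.
  by move/eqP: e2; rewrite sqrf_eq1 en1 => /eqP.
apply/funext => x; apply: planeP.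
  by rewrite phi0 [RHS]mxE eN1 /rot /refl /= !pt0 !pt1 mulrN !mulN1r !mulNr.
by rewrite phi1 [RHS]mxE eN1 /rot /refl /= !pt0 !pt1 mulrN mulN1r mulNr.
Qed.

Lemma amenable_translation : amenable (R := R) translation.
Proof.
apply: amenable_commute.
- by exists 0; apply/funext => x; rewrite add0r.
- by move=> _ _ [v ->] [w ->]; exists (v + w); apply/funext => x /=; rewrite addrA.
- by move=> _ _ [v ->] [w ->]; apply/funext => x /=; rewrite addrCA.
Qed.

Lemma amenable_rotation : amenable (R := R) rotation.
Proof.
apply: amenable_commute.
- exists 1, 0; split; first by rewrite expr1n expr0n addr0.
  by apply/funext => x; apply: planeP; rewrite !mxE/=; ring.
- move=> _ _ [a [b [ab ->]]] [c [d [cd ->]]].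
  exists (a * c - b * d), (a * d + b * c); split.
    by transitivity ((a ^+ 2 + b ^+ 2) * (c ^+ 2 + d ^+ 2)); [ring|rewrite ab cd mulr1].
  by apply/funext => x; apply: planeP; rewrite !mxE/=; ring.
- move=> _ _ [a [b [ab ->]]] [c [d [cd ->]]].
  by apply/funext => x; apply: planeP; rewrite !mxE/=; ring.
Qed.

Lemma amenable_reflection : amenable (R := R) reflection.
Proof.
have reflK : refl \o refl = id.
  by apply/funext => x; apply: planeP; rewrite !mxE//= opprK.
apply: amenable_commute; first by left.
  by move=> _ _ [->|->] [->|->]; rewrite ?reflK; rewrite /reflection; auto.
by move=> _ _ [->|->] [->|->].
Qed.

(** Two extensions: conjugation by the reflection turns [rot a b] into [rot a (- b)], and
    conjugation by a linear isometry turns the translation by [v] into the translation by the image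
    of [v]. *)
Lemma amenable_isometry : amenable (R := R) (@plane_isometry R).
Proof.
have -> : @plane_isometry R = fun phi => exists t g, [/\ translation t,
    exists r s, [/\ rotation r, reflection s & g = r \o s] & phi = t \o g].
  by apply/funext => phi; apply/propext; exact: plane_isometryP.
apply: (amenable_ext amenable_translation (Q := fun g => exists r s, _)).
  apply: (amenable_ext amenable_rotation amenable_reflection).
  move=> _ _ [->|->] [a [b [ab ->]]].
    by exists (rot a b) => //; exists a, b.
  exists (rot a (- b)); first by exists a, (- b); rewrite sqrrN.
  by apply/funext => x; apply: planeP; rewrite !mxE/=; ring.
move=> _ _ [_ [s [[a [b [ab ->]]] s01 ->]]] [v ->].
exists (+%R ((rot a b \o s) v)); first by eexists.
apply/funext => x; apply: planeP; case: s01 => -> /=; rewrite !mxE/=; ring.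
Qed.

End Isometries.

(** * Fractional colourings as weighted families of sets *)

Section WeightedFamilies.
Context {R : realType}.
Implicit Types (X Z S : {fset plane R}) (g : {fset plane R} -> R).
Implicit Types (x y : plane R) (Y : seq (plane R)).

(* A colouring is encoded as a finite family of weighted subsets of the whole
   plane; restricting it to a finite set or pulling it back along an isometry
   then leaves the weights untouched. *)
Definition wfamily := seq (R * (plane R -> bool)).

(** [mass M [::]] is the weight of the colouring and [mass M [:: x]] the total weight covering [x].
    With [Y] a list, moving it by an isometry is a plain [map]. *)
Definition mass (M : wfamily) (Y : seq (plane R)) : R :=
  \sum_(a <- M) a.1 * (all a.2 Y)%:R.

Definition colours (M : wfamily) X : Prop :=
  forall a, a \in M -> 0 <= a.1 /\
    {in X &, forall x y, a.2 x -> a.2 y -> ~~ unit_adj x y}.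

Lemma mass_ge0 M X Y : colours M X -> 0 <= mass M Y.
Proof.
move=> MX; rewrite /mass big_seq sumr_ge0// => a /MX[a0 _].
by rewrite mulr_ge0.
Qed.

Lemma mass_le_nil M X Y : colours M X -> mass M Y <= mass M [::].
Proof.
move=> MX; rewrite /mass big_seq [leRHS]big_seq ler_sum// => a /MX[a0 _].
by rewrite ler_wpM2l// ler_nat leq_b1.
Qed.

Lemma eq_mass M Y Y' : Y =i Y' -> mass M Y = mass M Y'.
Proof.
by move=> YY'; apply: eq_bigr => a _; rewrite (eq_all_r YY').
Qed.

Lemma sum_indep_sets X g (P : pred {fset plane R}) :
  (forall S, S \notin indep_sets X -> g S = 0) ->
  \sum_(S <- indep_sets X | P S) g S = \sum_(S <- fpowerset X | P S) g S.
Proof.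
move=> g0; rewrite big_mkcond [RHS]big_mkcond; apply: big_fset_incl.
  by apply/fsubsetP => S; rewrite !inE => /andP[].
by move=> S _ /g0 ->; case: ifP.
Qed.

Lemma independentP S :
  reflect {in S &, forall x y, ~~ unit_adj x y} (independent S).
Proof.
apply: (iffP forallP) => [SP x y xS yS|SP x].
  by have /forallP/(_ [` yS]) := SP [` xS].
by apply/forallP => y; apply: SP; exact: valP.
Qed.

Lemma wfamily_of_colouring X g : frac_colouring X g ->
  exists M, [/\ colours M X, mass M [::] = weight X g &
    forall x, x \in X -> 1 <= mass M [:: x]].
Proof.
move=> [g0 _ g1].
exists [seq (g T, fun x => x \in T) | T <- indep_sets X]; split.
- move=> _ /mapP[T TX ->] /=; split; first exact: g0.
  move=> x y _ _; apply: independentP.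
  by move: TX; rewrite !inE => /andP[].
- by rewrite /mass big_map /weight; apply: eq_bigr => S _; rewrite mulr1.
- move=> x /g1; rewrite /mass big_map big_mkcond => /le_trans; apply.
  by apply: ler_sum => S _ /=; rewrite andbT mulr_natr mulrb.
Qed.

(* Delete x from each set with probability 1 - 1 / mass M [:: x]. *)
Lemma colours_thin M X x : colours M X -> 1 <= mass M [:: x] ->
  exists M', [/\ colours M' X, mass M' [::] = mass M [::],
    mass M' [:: x] = 1 &
    forall y, y != x -> mass M' [:: y] = mass M [:: y]].
Proof.
move=> MX Mx; have Mx0 : 0 < mass M [:: x] by exact: lt_le_trans Mx.
pose p := (mass M [:: x])^-1.
have p0 : 0 <= p by rewrite invr_ge0 ltW.
have p1 : 0 <= 1 - p by rewrite subr_ge0 invf_le1.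
exists ([seq (p * a.1, a.2) | a <- M] ++
  [seq ((1 - p) * a.1, fun y => a.2 y && (y != x)) | a <- M]).
split.
- move=> b; rewrite mem_cat => /orP[] /mapP[a /MX[a0 aX] ->] /=.
    by split => //; exact: mulr_ge0.
  split; first exact: mulr_ge0.
  by move=> y z yX zX /andP[ay _] /andP[az _]; exact: aX.
- rewrite /mass big_cat !big_map/= -big_split/=.
  by apply: eq_bigr => a _; rewrite !mulr1 -mulrDl addrC subrK mul1r.
- rewrite {1}/mass big_cat !big_map/= [X in _ + X]big1 ?addr0.
    under eq_bigr do rewrite -mulrA.
    by rewrite -mulr_sumr mulVf// gt_eqF.
  by move=> a _; rewrite eqxx andbF mulr0.
- move=> y yx; rewrite /mass big_cat !big_map/= -big_split/=.
  by apply: eq_bigr => a _; rewrite yx !andbT -mulrDl -mulrDl addrC subrK mul1r.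
Qed.

(** The points of [X] are thinned one at a time; thinning at one point leaves the masses of the
    others unchanged. *)
Lemma colours_regularize M X :
  colours M X -> (forall x, x \in X -> 1 <= mass M [:: x]) ->
  exists M', [/\ colours M' X, mass M' [::] = mass M [::] &
    forall x, x \in X -> mass M' [:: x] = 1].
Proof.
move=> MX M1.
suff : forall s : seq (plane R), exists M', [/\ colours M' X,
    mass M' [::] = mass M [::],
    forall x, x \in X -> 1 <= mass M' [:: x] &
    forall x, x \in X -> x \in s -> mass M' [:: x] = 1].
  move=> /(_ (enum_fset X))[M' [M'X M'0 _ M'1]].
  by exists M'; split=> // x xX; exact: M'1.
elim=> [|x s [N [NX N0 N1 Ns]]]; first by exists M.
have [xX|xX] := boolP (x \in X); last first.
  exists N; split => // y yX; rewrite inE => /orP[/eqP yx|]; last exact: Ns.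
  by rewrite -yx yX in xX.
have [M' [M'X M'0 M'x M'y]] := colours_thin NX (N1 x xX).
exists M'; split => //; first by rewrite M'0.
  by move=> y yX; have [->|/M'y ->] := eqVneq y x; [rewrite M'x|exact: N1].
move=> y yX; rewrite inE; have [->//|/M'y -> /=] := eqVneq y x.
exact: Ns.
Qed.

(** * Averaging pullbacks along isometries *)

Definition average (L : seq (plane R -> plane R)) (M : wfamily) : wfamily :=
  [seq (a.1 / (size L)%:R, a.2 \o f) | f <- L, a <- M].

Lemma mass_average L M Y :
  mass (average L M) Y = mean L (fun f => mass M (map f Y)).
Proof.
rewrite /mass big_allpairs_dep /mean mulr_suml; apply: eq_bigr => f _.
rewrite mulr_suml; apply: eq_bigr => a _.
by rewrite /= all_map mulrAC.
Qed.

Lemma colours_average L M X Z :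
  colours M Z -> (forall f, f \in L -> plane_isometry f) ->
  (forall f x, f \in L -> x \in X -> f x \in Z) ->
  colours (average L M) X.
Proof.
move=> MZ Liso LX _ /allpairsP[[f a] [/= fL /MZ[a0 aZ] ->]] /=; split.
  by rewrite divr_ge0.
move=> x y xX yX ax ay; rewrite /unit_adj -(Liso f fL).
by apply: aZ => //; exact: LX.
Qed.

Lemma chi_f_colours X (B : R) : (chi_f X < B%:E)%E ->
  exists M, [/\ colours M X, mass M [::] < B &
    forall x, x \in X -> mass M [:: x] = 1].
Proof.
move=> /ereal_inf_lt[_ [g /= gX <-]]; rewrite lte_fin => gB.
have [N [NX N0 N1]] := wfamily_of_colouring gX.
have [M [MX M0 M1]] := colours_regularize NX N1.
by exists M; split => //; rewrite M0 N0.
Qed.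

Lemma almost_invariant_colours (B : R) X (s : seq (plane R -> plane R)) (e : R) :
  (forall Z, (chi_f Z < B%:E)%E) -> (forall f, f \in s -> plane_isometry f) ->
  0 < e ->
  exists M, [/\ colours M X, mass M [::] <= B,
    forall x, x \in X -> mass M [:: x] = 1 &
    forall f Y, f \in s ->
      `|mass M (map f Y) - mass M Y| <= e].
Proof.
move=> chiB siso e0.
have B0 : 0 < B.
  have [M [MX MB _]] := chi_f_colours (chiB X).
  by rewrite (le_lt_trans _ MB)// (mass_ge0 _ MX).
(* The masses lie in [[0, B]], so they are divided by [B] to serve as test functions, and the
   tolerance becomes [e / B]. *)
have [L [L0 Liso] Linv] := amenable_isometry siso (divr_gt0 e0 B0).
(* [Z] contains every image of [X] under [L], so each pullback is regular on [X]. *)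
pose Z := [fset (f : plane R -> plane R) x | f in L, x in X].
have LZ f x : f \in L -> x \in X -> f x \in Z.
  by move=> fL xX; apply/imfset2P; exists f => //; exists x.
have [M [MZ MB M1]] := chi_f_colours (chiB Z).
exists (average L M); split.
- exact: colours_average LZ.
- by rewrite mass_average /= mean_const// ltW.
- move=> x xX; rewrite mass_average -[RHS](mean_const 1 L0).
  by apply: eq_mean => f fL; apply: M1; exact: LZ.
- move=> f Y fs; rewrite !mass_average.
  have mB u : `|mass M (map u Y) / B| <= 1.
    rewrite ger0_norm; last by rewrite divr_ge0 ?(mass_ge0 _ MZ)// ltW.
    by rewrite ler_pdivrMr// mul1r (le_trans (mass_le_nil _ MZ))// ltW.
  have := Linv f fs (fun u => mass M (map u Y) / B) mB.
  rewrite {1 2}/mean -!mulr_suml !(mulrAC _ B^-1) -mulrBl normrM.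
  rewrite (@gtr0_norm _ B^-1) ?invr_gt0// ler_pM2r ?invr_gt0//.
  rewrite (_ : mean L (fun u => mass M (map u (map f Y))) =
    mean L (fun u => mass M (map (u \o f) Y)))//.
  by apply: eq_mean => u _; rewrite -map_comp.
Qed.

(** * From weighted families back to functions on subsets of [X] *)

Definition restrict X (M : wfamily) S : R :=
  \sum_(a <- M) a.1 * ([fset x in X | a.2 x] == S)%:R.

Lemma restrict_ge0 M X Z S : colours M Z -> 0 <= restrict X M S.
Proof.
move=> MX; rewrite /restrict big_seq sumr_ge0// => a /MX[a0 _].
by rewrite mulr_ge0.
Qed.

Lemma restrict_out M X S : colours M X -> S \notin indep_sets X ->
  restrict X M S = 0.
Proof.
move=> MX SX; rewrite /restrict big_seq big1// => a /MX[_ aX].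
have [SE|] := eqVneq; last by rewrite mulr0.
case/negP: SX; rewrite -SE !inE; apply/andP; split.
  by rewrite fpowersetE; apply/fsubsetP => x; rewrite !inE => /andP[].
apply/independentP => x y; rewrite !inE => /andP[xX ax] /andP[yX ay].
exact: aX.
Qed.

(** Each member contributes only through its trace on [X], and as [Y] lies in [X] the trace contains
    [Y] exactly when the member does. *)
Lemma sum_restrict M X (Y : {fset plane R}) : Y `<=` X ->
  \sum_(S <- fpowerset X | Y `<=` S) restrict X M S = mass M (enum_fset Y).
Proof.
move=> YX; rewrite /restrict exchange_big; apply: eq_bigr => a _ /=.
rewrite -mulr_sumr; congr (_ * _).
set T := [fset x in X | a.2 x].
have TX : T \in fpowerset X.
  by rewrite fpowersetE; apply/fsubsetP => x; rewrite !inE => /andP[].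
rewrite big_mkcond (bigD1_seq T)//= ?fset_uniq//.
rewrite big1 ?addr0 => [|S /negbTE ST]; last first.
  by rewrite eq_sym ST; case: ifP.
rewrite eqxx (_ : Y `<=` T = all a.2 (enum_fset Y)); first by case: all.
apply/fsubsetP/allP => [YT x /YT|Ya x xY]; first by rewrite !inE => /andP[].
by rewrite !inE (fsubsetP YX)// Ya.
Qed.

End WeightedFamilies.

(** * Limits of bounded real sequences along an ultrafilter *)

Section UltraLimit.
Context {R : realType}.

(** Compactness of [[a, b]] gives a cluster point, and a cluster point of an ultrafilter is a limit:
    otherwise the complement of a neighbourhood would be large. *)
Lemma ultra_cvg_bounded {T : Type} (U : set_system T) (f : T -> R) (a b : R) :
  UltraFilter U -> (forall t, a <= f t <= b) ->
  exists l : R, f t @[t --> U] --> l.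
Proof.
move=> UU fab; have PU := @ultra_proper _ _ UU.
have [l [_ fl]] : (`[a, b] `&` cluster (f t @[t --> U]))%classic !=set0.
  apply: (@segment_compact _ a b (fmap f U) _).
  by apply: (@filterE _ U) => t; rewrite /= in_itv/=.
exists l => V Vl.
have [//|UVc] := in_ultra_setVsetC (f @^-1` V) UU.
have [y [Vcy Vy]] := fl (~` V) V UVc Vl.
by case: Vcy.
Qed.

(** Since [U] contains the cofinite filter, the error [n.+1%:R^-1] tends to 0 along it. *)
Lemma ultra_lim_le (U : set_system nat) (f : nat -> R) (l c : R) :
  UltraFilter U -> (\oo `<=` U)%classic -> f n @[n --> U] --> l ->
  (forall n, f n <= c + n.+1%:R^-1) -> l <= c.
Proof.
move=> UU ooU fl fc; have PU := @ultra_proper _ _ UU.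
apply/ler_addgt0Pr => e e0.
rewrite -(cvg_lim _ fl)//; apply: limr_le; first by apply/cvg_ex; exists l.
apply: ooU; near=> n; apply: le_trans (fc n) _; rewrite lerD2l ltW//.
by near: n; exact: near_infty_natSinv_lt (PosNum e0).
Unshelve. all: by end_near. Qed.

End UltraLimit.

(** * Comparison of the two chromatic numbers *)

Section ChromaticNumbers.
Context {R : realType}.

Lemma chi_gf_le (X : {fset plane R}) (B : R) :
  (forall Z : {fset plane R}, (chi_f Z <= B%:E)%E) -> (chi_gf X <= B%:E)%E.
Proof.
move=> chiB.
(* One isometry is fixed per pair of sets, the identity for non-congruent pairs; the finitely many
   subsets of [X] then yield a finite list [s]. *)
have [phi phiP] : exists phi : {fset plane R} * {fset plane R} -> (plane R -> plane R),
    forall Y, plane_isometry (phi Y) /\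
      (congruent Y.1 Y.2 -> Y.2 = [fset phi Y y | y in Y.1]).
  suff /boolp.choice[phi phiP] : forall Y : {fset plane R} * {fset plane R},
      exists f : plane R -> plane R, plane_isometry f /\
      (congruent Y.1 Y.2 -> Y.2 = [fset f y | y in Y.1]) by exists phi.
  move=> [Y Y'] /=; have [[f [fiso YE]]|nYY'] := pselect (congruent Y Y').
    by exists f.
  by exists id; split.
pose s := [seq phi (Y, Y') | Y <- fpowerset X, Y' <- fpowerset X].
have siso f : f \in s -> plane_isometry f.
  by move=> /allpairsP[[Y Y'] [_ _ ->]]; have [] := phiP (Y, Y').
have /boolp.choice[M MP] n : exists M : wfamily, [/\ colours M X,
    mass M [::] <= B + n.+1%:R^-1,
    forall x, x \in X -> mass M [:: x] = 1 &
    forall f Y, f \in s -> `|mass M (map f Y) - mass M Y| <= n.+1%:R^-1].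
  apply: almost_invariant_colours => // Z.
  by rewrite (le_lt_trans (chiB Z))// lte_fin ltrDl invr_gt0.
have MX n : colours (M n) X by have [] := MP n.
pose G n S := restrict X (M n) S.
have [U [UU ooU]] := ultraFilterLemma eventually_filter.
have PU := @ultra_proper _ _ UU.
have [g gP] : exists g : {fset plane R} -> R, forall S, G n S @[n --> U] --> g S.
  suff /boolp.choice[g gP] : forall S, exists l : R, G n S @[n --> U] --> l by exists g.
  move=> S; apply: (@ultra_cvg_bounded _ _ _ _ 0 (B + 1)) => // n.
  rewrite (restrict_ge0 _ _ (MX n))/=.
  have [_ MB _ _] := MP n; apply: (@le_trans _ _ (B + n.+1%:R^-1)).
    apply: le_trans MB; rewrite /G /restrict /mass [leLHS]big_seq [leRHS]big_seq.
    apply: ler_sum => a /MX[a0 _]; rewrite ler_wpM2l// ler_nat.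
    exact: leq_b1.
  by rewrite lerD2l invf_le1// ler1n.
have sumP (P : pred {fset plane R}) :
    \sum_(S <- fpowerset X | P S) G n S @[n --> U] -->
    \sum_(S <- fpowerset X | P S) g S.
  by apply: cvg_big => [|S _]; [exact: add_continuous|exact: gP].
have g_out S : S \notin indep_sets X -> g S = 0.
  move=> SX; rewrite -(cvg_lim _ (gP S))//.
  rewrite (_ : (fun n => G n S) = fun=> 0) ?lim_cst//.
  by apply/funext => n; exact: restrict_out.
have g_mass (Y : {fset plane R}) : Y `<=` X ->
    mass (M n) (enum_fset Y) @[n --> U] --> \sum_(S <- fpowerset X | Y `<=` S) g S.
  move=> YX; have := sumP (fun S => Y `<=` S).
  by under eq_fun do rewrite sum_restrict//.
have g_reg x : x \in X -> \sum_(S <- indep_sets X | x \in S) g S = 1.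
  move=> xX; rewrite sum_indep_sets//.
  have xsX : [fset x] `<=` X by rewrite fsub1set.
  under eq_bigl do rewrite -fsub1set.
  rewrite -(cvg_lim _ (g_mass _ xsX))//.
  rewrite (_ : (fun n => _) = fun=> 1) ?lim_cst//.
  apply/funext => n; have [_ _ /(_ _ xX) <- _] := MP n.
  by apply: eq_mass => y; rewrite !inE.
(* Exact invariance, stated as a bound by 0 so that the errors [n.+1%:R^-1] can be removed in the
   limit. *)
have g_le (Y Y' : {fset plane R}) : Y `<=` X -> Y' `<=` X -> congruent Y Y' ->
    `|\sum_(S <- fpowerset X | Y `<=` S) g S -
      \sum_(S <- fpowerset X | Y' `<=` S) g S| <= 0.
  move=> YX Y'X YY'.
  apply: (ultra_lim_le UU ooU (cvg_norm (cvgB (g_mass _ YX) (g_mass _ Y'X)))).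
  move=> n; rewrite add0r distrC.
  have [_ /(_ YY')/= Y'E] := phiP (Y, Y').
  set f := phi (Y, Y') in Y'E; have [_ _ _ /(_ f (enum_fset Y))] := MP n.
  rewrite (_ : mass (M n) (map _ _) = mass (M n) (enum_fset Y')).
    by apply; apply/allpairsP; exists (Y, Y'); rewrite !fpowersetE.
  apply: eq_mass => y; rewrite Y'E.
  apply/idP/idP => [/mapP[z zY ->]|/imfsetP[z zY ->]].
    exact: in_imfset.
  exact: map_f.
have gX : geom_frac_colouring X g.
  split => //.
    split => // [S SX|x xX]; last by rewrite g_reg.
    rewrite -(cvg_lim _ (gP S))//; apply: limr_ge.
      by apply/cvg_ex; exists (g S).
    by apply: filterE => n; exact: restrict_ge0 (MX n).
  move=> Y Y' YX Y'X YY'; apply/eqP.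
  by rewrite -subr_eq0 -normr_le0 g_le.
apply: (@le_trans _ _ (weight X g)%:E).
  by apply: ereal_inf_lbound; exists g.
rewrite lee_fin /weight sum_indep_sets//.
(* The weight is the limit mass at the empty set, so [g_mass] applies to it as well. *)
rewrite (eq_bigl (fun S : {fset plane R} => fset0 `<=` S)); last first.
  by move=> S; rewrite fsub0set.
apply: (ultra_lim_le UU ooU (g_mass _ (fsub0set X))) => n.
rewrite (eq_mass _ (Y' := [::])) => [|y]; last by rewrite inE.
by have [_ -> _ _] := MP n.
Qed.

End ChromaticNumbers.

Theorem theorem1 (R : realType) : chi_gf0 R = chi_f0 R.
Proof.
apply/eqP; rewrite eq_le; apply/andP; split; last first.
  apply: ge_ereal_sup => _ [X _ <-].
  apply: (@le_trans _ _ (chi_gf X)); last by apply: ereal_sup_ubound; exists X.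
  (* Geometric fractional colourings are fractional colourings, so the infimum defining [chi_f] runs
     over a larger set. *)
  apply: ereal_inf_le_tmp => _ [g gX <-]; exists g => //=.
  exact: geom_frac_colouringW gX.
apply: ge_ereal_sup => _ [X _ <-].
have chi_le (Z : {fset plane R}) : (chi_f Z <= chi_f0 R)%E.
  by apply: ereal_sup_ubound; exists Z.
(* The value [+oo] is trivial, and [-oo] is excluded since weights are nonnegative. *)
case E : (chi_f0 R) => [B| |]; last 2 first.
- exact: leey.
- have := chi_le X; rewrite E leeNy_eq => /eqP chiX.
  suff : (0 <= chi_f X)%E by rewrite chiX.
  apply: le_ereal_inf_tmp => _ [g [g0 _ _] <-].
  by rewrite lee_fin /weight big_seq sumr_ge0.
- by apply: chi_gf_le => Z; rewrite -E.
Qed.
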